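(* The number of unoriented cyclic normal quotients that a basic pair $(\Gamma,G)\in\mathcal{OG}(4)$ can have can be unboundedly large; that is, for every integer $m\geq 1$ there exists a basic pair $(\Gamma,G)\in\mathcal{OG}(4)$ having at least $m$ distinct $G$-unoriented cyclic normal quotients.
   Context: All groups and graphs are finite; graphs are simple and undirected. For $G\le \mathrm{Aut}(\Gamma)$, $\Gamma$ is $G$-oriented if $G$ is transitive on the vertices and on the edges of $\Gamma$ but not on the arcs (ordered pairs of adjacent vertices). $\mathcal{OG}(4)$ is the set of pairs $(\Gamma,G)$ with $\Gamma$ a connected $4$-valent graph, $G\leq \mathrm{Aut}(\Gamma)$, and $\Gamma$ $G$-oriented. For $N\unlhd G$, the $G$-normal quotient $\Gamma_N$ is the graph whose vertices are the $N$-orbits on $V\Gamma$, two distinct $N$-orbits being adjacent iff there is an edge of $\Gamma$ between a vertex of one and a vertex of the other. $\tilde N$ denotes the kernel of the action of $G$ on the set of $N$-orbits in $V\Gamma$. $\mathbf{C}_r$ ($r\ge 3$) denotes the cycle graph with $r$ vertices. $\Gamma_N$ is degenerate if it is isomorphic to $K_1$, $K_2$ or $\mathbf{C}_r$ for some $r\geq 3$. The pair $(\Gamma,G)\in\mathcal{OG}(4)$ is basic if $\Gamma_N$ is degenerate for every nontrivial normal subgroup $N$ of $G$. A cyclic normal quotient is a $\Gamma_N$, $N\unlhd G$, isomorphic to $\mathbf{C}_r$ for some $r\geq 3$; it is $G$-unoriented if $G/\tilde N\cong D_r$ (dihedral of order $2r$). *)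

(* Defs.v *)
From HB Require Import structures.
From mathcomp Require Import all_boot all_fingroup all_solvable.

Set Implicit Arguments.
Unset Strict Implicit.
Unset Printing Implicit Defensive.

Local Open Scope group_scope.

Record sgraph := SGraph {
  svertex :> finType;
  sedge : rel svertex;
  sedge_sym : symmetric sedge;
  sedge_irr : irreflexive sedge
}.

Definition graph_iso (X Y : sgraph) : Prop :=
  exists2 f : X -> Y, bijective f & forall x y, sedge (f x) (f y) = sedge x y.

Section CompleteGraph.
Variable n : nat.

Definition complete_edge : rel 'I_n := fun i j => i != j.

Fact complete_edge_sym : symmetric complete_edge.
Proof. by move=> i j; rewrite /complete_edge eq_sym. Qed.

Fact complete_edge_irr : irreflexive complete_edge.
Proof. by move=> i; rewrite /complete_edge eqxx. Qed.

Definition complete_graph := SGraph complete_edge_sym complete_edge_irr.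
End CompleteGraph.

Section CycleGraph.
Variable r : nat.

(* The conjunct [i != j] only matters for r = 1, which is never used. *)
Definition cycle_edge : rel 'I_r := fun i j =>
  (i != j) && ((j == i.+1 %% r :> nat) || (i == j.+1 %% r :> nat)).

Fact cycle_edge_sym : symmetric cycle_edge.
Proof. by move=> i j; rewrite /cycle_edge eq_sym orbC. Qed.

Fact cycle_edge_irr : irreflexive cycle_edge.
Proof. by move=> i; rewrite /cycle_edge eqxx. Qed.

Definition cycle_graph := SGraph cycle_edge_sym cycle_edge_irr.
End CycleGraph.

Section OrientedGraphs.
Variable Gam : sgraph.
Implicit Types G N : {group {perm Gam}}.

Definition connected_graph : Prop := forall x y : Gam, connect (@sedge Gam) x y.

Definition regular_graph (k : nat) : Prop :=
  forall x : Gam, #|[set y | sedge x y]| = k.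

Definition aut_graph : {set {perm Gam}} :=
  [set g : {perm Gam} | [forall x, forall y, sedge (g x) (g y) == sedge x y]].

Definition edge_set : {set {set Gam}} :=
  [set [set p.1; p.2] | p : Gam * Gam & sedge p.1 p.2].

Definition arc_transitive G : Prop :=
  forall x y x' y' : Gam, sedge x y -> sedge x' y' ->
    exists2 g, g \in G & g x = x' /\ g y = y'.

Definition oriented G : Prop :=
  [/\ [transitive G, on [set: Gam] | 'P],
      [transitive G, on edge_set | 'P^*]
    & ~ arc_transitive G].

Definition OG4 G : Prop :=
  [/\ connected_graph, regular_graph 4, G \subset aut_graph & oriented G].

Definition orbit_set N : {set {set Gam}} := orbit 'P N @: [set: Gam].

Section NormalQuotient.
Variable N : {group {perm Gam}}.

Definition quotient_vertex : finType := {B : {set Gam} | B \in orbit_set N}.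

Definition quotient_edge : rel quotient_vertex := fun A B =>
  (A != B) && [exists x in val A, exists y in val B, sedge x y].

Fact quotient_edge_sym : symmetric quotient_edge.
Proof.
move=> A B; rewrite /quotient_edge eq_sym; congr (_ && _).
apply/existsP/existsP=> -[x /andP[xA /existsP[y /andP[yB xy]]]];
  by exists y; rewrite yB; apply/existsP; exists x; rewrite xA sedge_sym.
Qed.

Fact quotient_edge_irr : irreflexive quotient_edge.
Proof. by move=> A; rewrite /quotient_edge eqxx. Qed.

Definition normal_quotient := SGraph quotient_edge_sym quotient_edge_irr.
End NormalQuotient.

(* The subgroup of the elements of G fixing every N-orbit setwise. *)
Definition orbit_kernel G N : {set {perm Gam}} := 'C_G(orbit_set N | 'P^*).

Definition basic G : Prop :=
  forall N, N <| G -> N :!=: 1 ->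
    [\/ graph_iso (normal_quotient N) (complete_graph 1),
        graph_iso (normal_quotient N) (complete_graph 2)
      | exists2 r, 3 <= r & graph_iso (normal_quotient N) (cycle_graph r)].

(* mathcomp indexes dihedral groups by their order: 'D_(r.*2) is D_r. *)
Definition unoriented_cyclic_quotient G N : Prop :=
  N <| G /\
  exists r, [/\ 3 <= r, graph_iso (normal_quotient N) (cycle_graph r)
              & G / orbit_kernel G N \isog 'D_(r.*2)].

End OrientedGraphs.

(* Main.v *)
Require Import Defs.
From mathcomp Require Import all_boot all_fingroup all_solvable.
From mathcomp Require Import zmodp zify.

(** The examples are semidihedral groups acting on circulant graphs.  Take
    r = 2 ^ m.+1.  The graph has vertex set Z/2r, and x is adjacent to y when
    x and y differ by 1 or -1 modulo r (not 2r), so x has the four neighbours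
    x + 1, x - 1, x + 1 + r, x - 1 + r.  The group G is generated by the
    rotation x |-> x + 1 and the flip x |-> (r - 1) x; since r is even,
    (r - 1) ^ 2 = 1 modulo 2r, and G is semidihedral of order 4r.

    G preserves the orientation made of the arcs x -> x + 1 and
    x -> x + r - 1, which orients every edge in exactly one way.  The flip
    exchanges the two arcs leaving 0 and rotations carry 0 to every vertex, so
    G is transitive on arcs of the orientation, hence on edges, but it never
    reverses an edge.  This gives a pair in OG(4).

    The pair is basic because G contains a regular cyclic 2-group: the orbits
    of a normal subgroup N are blocks for the rotations, so they are the
    residue classes modulo some divisor d of 2r ([normal_orbits_mod]), and
    d < 2r when N is nontrivial ([orbits_mod_full]).  As 2r is a power of 2,
    d divides r.  But then adjacency descends to being consecutive modulo d,
    and the normal quotient is the cycle of length d ([quotient_cycle]), which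
    is the complete graph when d is 1 or 2.

    Finally, each d = 2 ^ i.+2 with i < m divides r, and the normal subgroup
    generated by the d-th power of the rotation has the classes modulo d as
    orbits.  There the flip acts as x |-> - x, so the group induced on the
    classes is the dihedral group of order 2d ([kernel_quotient_dihedral]).
    These m quotients have different numbers of vertices. *)

Set Implicit Arguments.
Unset Strict Implicit.
Unset Printing Implicit Defensive.

Local Open Scope group_scope.

(** * Permutations and their orbits *)

Section RelationStabiliser.
Variables (T : finType) (e : rel T).

Definition rel_aut : {set {perm T}} :=
  [set g : {perm T} | [forall x, forall y, e (g x) (g y) == e x y]].

Lemma rel_autP (g : {perm T}) :
  reflect (forall x y, e (g x) (g y) = e x y) (g \in rel_aut).
Proof.
rewrite inE; apply: (iffP forallP) => [h x y | h x].
  by apply/eqP; have /forallP := h x.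
by apply/forallP=> y; apply/eqP.
Qed.

Lemma group_set_rel_aut : group_set rel_aut.
Proof.
apply/group_setP; split=> [|g h /rel_autP pg /rel_autP ph].
  by apply/rel_autP=> x y; rewrite !perm1.
by apply/rel_autP=> x y; rewrite !permM ph pg.
Qed.
Canonical rel_aut_group := Group group_set_rel_aut.
End RelationStabiliser.

Lemma setact_pair (T : finType) (g : {perm T}) x y :
  ('P^* )%act [set x; y] g = [set g x; g y].
Proof. by rewrite /= /setact imsetU !imset_set1. Qed.

Lemma orbit_norm (T : finType) (N : {group {perm T}}) u x y :
  u \in 'N(N) -> (u y \in orbit 'P N (u x)) = (y \in orbit 'P N x).
Proof.
move=> nNu; have /= := orbit_conjsg 'P N u x y.
by rewrite (normP nNu).
Qed.

(** * The graph and its orientation *)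

Section SemidihedralGraph.
Variable r : nat.
Hypotheses (r_gt2 : 2 < r) (r_even : ~~ odd r).

(** The shape [_.-1.+1] of the bound gives access to the projection [inZp]
    from the natural numbers; all arithmetic is done on natural numbers modulo
    [r.*2] and projected by [red]. *)
Definition vertex := 'I_(r.*2).-1.+1.
Definition red (a : nat) : vertex := inZp a.

Lemma val_red a : red a = a %% r.*2 :> nat.
Proof. by rewrite /= prednK // double_gt0; apply: leq_trans r_gt2. Qed.

Lemma red_eq a b : (red a == red b) = (a == b %[mod r.*2]).
Proof. by rewrite -(inj_eq (@ord_inj _)) !val_red. Qed.

Lemma redK (x : vertex) : red x = x.
Proof. exact: valZpK. Qed.

Lemma vertex_eq (x y : vertex) : (x == y) = (x == y %[mod r.*2]).
Proof. by rewrite -red_eq !redK. Qed.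

Lemma red_mod d a : d %| r.*2 -> red a = a %[mod d].
Proof. by move=> dv; rewrite val_red modn_dvdm. Qed.

Definition adj : rel vertex :=
  fun x y => (y == x.+1 %[mod r]) || (x == y.+1 %[mod r]).

Lemma adj_sym : symmetric adj.
Proof. by move=> x y; rewrite /adj orbC. Qed.

Lemma eqmod_addl_small a c c' M : c < M -> c' < M ->
  (a + c == a + c' %[mod M]) = (c == c').
Proof. by move=> h h'; rewrite eqn_modDl !modn_small. Qed.

Lemma adj_irr : irreflexive adj.
Proof.
move=> x; rewrite /adj orbb -(addn1 x) -[X in X %% _ == _]addn0 eqmod_addl_small //.
  exact: leq_trans r_gt2.
exact: ltnW.
Qed.

Definition sd_graph := SGraph adj_sym adj_irr.

Lemma rot_inj : injective (fun x : vertex => red x.+1).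
Proof.
move=> x y /eqP; rewrite red_eq -(addn1 x) -(addn1 y) eqn_modDr => h.
by apply/eqP; rewrite vertex_eq.
Qed.

(** This is where the evenness of r matters: it makes x |-> (r - 1) x an
    involution modulo 2r.  With r = 2s, (2s - 1)^2 = (s - 1) 4s + 1. *)
Lemma pred_sq : r.-1 * r.-1 = 1 %[mod r.*2].
Proof.
have er : r = r./2.*2 by rewrite even_halfK.
have sgt : 0 < r./2 by rewrite -double_gt0 -er; apply: leq_trans r_gt2.
rewrite er; case: (r./2) sgt => // s _.
have -> : (s.+1.*2.-1 * s.+1.*2.-1)%N = (s * s.+1.*2.*2 + 1)%N by lia.
exact: modnMDl.
Qed.

Definition rot : {perm vertex} := perm rot_inj.

Lemma refl_invol : involutive (fun x : vertex => red (r.-1 * x)).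
Proof.
move=> x; apply/eqP; rewrite vertex_eq val_red modn_mod val_red modnMmr.
by rewrite mulnA -modnMml pred_sq modnMml mul1n.
Qed.

Definition flip : {perm vertex} := perm (inv_inj refl_invol).

Definition sd_group : {group {perm vertex}} := <<[set rot; flip]>>%G.

Lemma rot_in : rot \in sd_group.
Proof. by rewrite mem_gen ?set21. Qed.

Lemma flip_in : flip \in sd_group.
Proof. by rewrite mem_gen ?set22. Qed.

Lemma rotE x : rot x = red x.+1. Proof. exact: permE. Qed.
Lemma flipE x : flip x = red (r.-1 * x). Proof. exact: permE. Qed.

Lemma rot_red a : rot (red a) = red a.+1.
Proof.
by apply/eqP; rewrite rotE red_eq val_red -addn1 modnDml addn1.
Qed.

Lemma flip_red a : flip (red a) = red (r.-1 * a).
Proof. by apply/eqP; rewrite flipE red_eq val_red modnMmr. Qed.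

Lemma rotX_red j a : (rot ^+ j) (red a) = red (a + j).
Proof.
elim: j => [|j IH]; first by rewrite expg0 perm1 addn0.
by rewrite expgSr permM IH rot_red addnS.
Qed.

Lemma flip2 : flip * flip = 1.
Proof. by apply/permP=> x; rewrite permM perm1 !permE refl_invol. Qed.

(** The semidihedral relation. *)
Lemma rot_flip : rot ^ flip = rot ^+ r.-1.
Proof.
apply/permP=> x; rewrite conjgE (_ : flip^-1 = flip); last first.
  by apply/eqP; rewrite eq_invg_mul flip2.
rewrite -[x]redK !permM flip_red rot_red flip_red rotX_red; apply/eqP.
rewrite red_eq mulnS addnC mulnA -modnDml -modnMml pred_sq modnMml mul1n.
by rewrite modnDml.
Qed.

(** Both kinds of arcs are needed: the flip sends an arc of the first kind to
    one of the second, and conversely since r - 1 squares to 1. *)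
Definition arc : rel vertex :=
  fun x y => (y == x + 1 %[mod r.*2]) || (y == x + r.-1 %[mod r.*2]).

(** A class modulo r is the union of two classes modulo 2r. *)
Lemma eqmod_double a b :
  (a == b %[mod r]) = (a == b %[mod r.*2]) || (a == b + r %[mod r.*2]).
Proof.
have r_gt0 : 0 < r by lia.
have small c : c < r.*2 -> c %% r = if c < r then c else c - r.
  move=> c2; case: ltnP => [|rc]; first exact: modn_small.
  by rewrite -{1}(subnK rc) modnDr modn_small //; lia.
have r2 : r %| r.*2 by rewrite -muln2 dvdn_mulr.
rewrite -(modn_dvdm a r2) -(modn_dvdm b r2) -(modnDml b).
have : a %% r.*2 < r.*2 by rewrite ltn_pmod ?double_gt0.
have : b %% r.*2 < r.*2 by rewrite ltn_pmod ?double_gt0.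
move: (a %% _) (b %% _) => c d d2 c2.
have -> : (d + r) %% r.*2 = if d < r then d + r else d - r.
  case: ltnP => dr; first by rewrite modn_small //; lia.
  by rewrite -{1}(subnK dr) -addnA addnn modnDr modn_small //; lia.
rewrite !small //; case: (ltnP c r) => hc; case: (ltnP d r) => hd; lia.
Qed.

Lemma arc_red a b : arc (red a) (red b) =
  (b == a + 1 %[mod r.*2]) || (b == a + r.-1 %[mod r.*2]).
Proof. by rewrite /arc !val_red -!(modnDml (a %% _)) !modn_mod !modnDml. Qed.

(** The four residues 1, r + 1, -1, r - 1 modulo 2r that lie over 1 and -1
    modulo r are the two arc steps 1, r - 1 and their opposites. *)
Lemma adjE x y : adj x y = arc x y || arc y x.
Proof.
rewrite /adj /arc !eqmod_double.
have -> : (x == y.+1 %[mod r.*2]) = (x == y + 1 %[mod r.*2]) by rewrite addn1.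
have -> : (y == x.+1 %[mod r.*2]) = (y == x + 1 %[mod r.*2]) by rewrite addn1.
have aux (a b : nat) : (a == b.+1 + r %[mod r.*2]) = (b == a + r.-1 %[mod r.*2]).
  rewrite -(eqn_modDr r.-1) eq_sym.
  have -> : (b.+1 + r + r.-1 = b + r.*2)%N by lia.
  by rewrite modnDr.
by rewrite !aux; do 4!case: (_ == _).
Qed.

Lemma rot_arc : rot \in rel_aut arc.
Proof.
apply/rel_autP => x y; rewrite -[x]redK -[y]redK !rot_red !arc_red.
by rewrite -(addn1 x) -(addn1 y) (addnAC x 1%N r.-1) !eqn_modDr.
Qed.

Lemma flip_arc : flip \in rel_aut arc.
Proof.
have aux x y : arc x y -> arc (flip x) (flip y).
  rewrite -[x]redK -[y]redK !flip_red !arc_red.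
  case/orP=> /eqP h; apply/orP; [right | left].
    by rewrite -modnMmr h modnMmr mulnDr muln1.
  by rewrite -modnMmr h modnMmr mulnDr -modnDmr pred_sq modnDmr.
have flipK x : flip (flip x) = x by rewrite !permE refl_invol.
apply/rel_autP => x y; apply/idP/idP; last exact: aux.
by rewrite -{2}[x]flipK -{2}[y]flipK; apply: aux.
Qed.

Lemma sd_group_arc : sd_group \subset rel_aut arc.
Proof. by rewrite gen_subG subUset !sub1set rot_arc flip_arc. Qed.

Lemma sd_group_aut : sd_group \subset aut_graph sd_graph.
Proof.
apply: subset_trans sd_group_arc _; apply/subsetP=> g /rel_autP arcg.
rewrite inE; apply/forallP=> x; apply/forallP=> y.
by rewrite /= !adjE !arcg.
Qed.

(** * Membership in OG(4) *)

Lemma sd_connected : connected_graph sd_graph.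
Proof.
move=> x y.
have sym : connect_sym adj by apply: sym_connect_sym; apply: adj_sym.
have from0 z : connect adj (red 0) z.
  rewrite -[z]redK; elim: {z}(z : nat) => [|a]; first exact: connect0.
  move/connect_trans; apply; apply: connect1.
  by rewrite adjE arc_red addn1 eqxx.
by apply: connect_trans (from0 y); rewrite sym.
Qed.

Lemma sd_regular : regular_graph sd_graph 4.
Proof.
move=> x.
have back (y : vertex) c c' : c + c' = r.*2 ->
    (x == y + c %[mod r.*2]) = (y == red (x + c')).
  move=> cc; rewrite -[X in X == red _]redK red_eq -(eqn_modDr c').
  by rewrite -addnA cc modnDr eq_sym.
have -> : [set y | @sedge sd_graph x y] =
   red (x + 1) |: (red (x + r.-1) |: [set red (x + r.*2.-1); red (x + r.+1)]).
  apply/setP=> y; rewrite !inE /= adjE /arc -!(red_eq y) redK.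
  rewrite (back y 1%N r.*2.-1) ?(back y r.-1 r.+1); first by rewrite !orbA.
    by lia.
  by lia.
rewrite !cardsU1 cards1 !inE !red_eq !eqmod_addl_small; lia.
Qed.

Lemma sd_transitive : [transitive sd_group, on [set: sd_graph] | 'P].
Proof.
apply/imsetP; exists (red 0) => //; apply/setP=> y; rewrite inE; symmetry.
by apply/imsetP; exists (rot ^+ y); rewrite ?groupX ?rot_in //= /aperm rotX_red redK.
Qed.

(** An arc of the first kind at x is the rotation by x of the arc from 0 to 1,
    and one of the second kind is the rotation by x of its flip. *)
Lemma arc_orbit x y : arc x y ->
  exists2 g, g \in sd_group & x = g (red 0) /\ y = g (red 1).
Proof.
rewrite -[x]redK -[y]redK arc_red -!red_eq.
case/orP=> /eqP ->.
  by exists (rot ^+ x); rewrite ?groupX ?rot_in // !rotX_red add0n addnC.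
exists (flip * rot ^+ x); first by rewrite groupM ?groupX ?rot_in ?flip_in.
by rewrite !permM !flip_red !rotX_red muln0 add0n muln1 addnC.
Qed.

Lemma arc01 : arc (red 0) (red 1).
Proof. by rewrite arc_red eqxx. Qed.

(** Going from 1 back to 0 would need 2 or r to vanish modulo 2r: the
    orientation is asymmetric, so no element of G reverses the edge 01. *)
Lemma arc10 : arc (red 1) (red 0) = false.
Proof.
rewrite arc_red !modn_small; lia.
Qed.

Lemma sd_oriented : oriented (Gam := sd_graph) sd_group.
Proof.
split; first exact: sd_transitive.
  apply/imsetP; exists [set red 0; red 1].
    by apply/imsetP; exists (red 0, red 1); rewrite // inE /= adjE arc01.
  apply/setP=> E; apply/imsetP/imsetP=> [[[x y]]|[g Gg ->]].
    have edge_img (u v : vertex) : arc u v -> exists2 g, g \in sd_group &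
       [set u; v] = ('P^* )%act [set red 0; red 1] g.
      case/arc_orbit=> g Gg [-> ->]; exists g => //.
      exact/esym/setact_pair.
    rewrite inE /= adjE => /orP[] /edge_img[g Gg eg] ->; exists g => //.
    by rewrite setUC.
  exists (g (red 0), g (red 1)); last exact: setact_pair.
  have /rel_autP arcg := subsetP sd_group_arc g Gg.
  by rewrite inE /= adjE arcg arc01.
move=> /(_ (red 0) (red 1) (red 1) (red 0)) [||g Gg [g0 g1]].
- by rewrite /= adjE arc01.
- by rewrite /= adjE arc01 orbT.
have /rel_autP/(_ (red 0) (red 1)) := subsetP sd_group_arc g Gg.
by rewrite arc01 g0 g1 arc10.
Qed.

(** * Orbits of normal subgroups *)

Definition orbits_mod (N : {group {perm vertex}}) d :=
  forall x y, (y \in orbit 'P N x) = (x == y %[mod d]).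

(** Equivalence under N is invariant under rotation, so the orbit of 0 is a
    subgroup of Z/2r and the other orbits are its cosets.  The generator d is
    obtained as the least positive a, possibly 2r itself, such that a and 0
    are in the same orbit. *)
Lemma normal_orbits_mod (N : {group {perm vertex}}) : N <| sd_group ->
  exists d, [/\ 0 < d, d %| r.*2 & orbits_mod N d].
Proof.
case/andP=> _ nN.
pose R (a b : nat) := red b \in orbit 'P N (red a).
have R0 a : R a a by apply: orbit_refl.
have Rtrans a b c : R a b -> R b c -> R a c.
  by rewrite /R => ab bc; apply: orbit_trans bc ab.
have Rsym a b : R a b = R b a by apply: orbit_sym.
have shift j a b : R (a + j) (b + j) = R a b.
  rewrite /R -!(rotX_red j) orbit_norm //.
  by apply: (subsetP nN); rewrite groupX ?rot_in.
have R2 : R 0 r.*2.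
  have e : red r.*2 = red 0 by apply/eqP; rewrite red_eq modnn mod0n.
  by rewrite /R e; apply: R0.
have exP : exists a, (0 < a) && R 0 a.
  by exists r.*2; rewrite R2 andbT double_gt0; lia.
case: (ex_minnP exP) => d /andP[d_gt0 Rd] mind; exists d.
have Rmul q : R 0 (q * d)%N.
  elim: q => // q IH; apply: (Rtrans _ _ _ IH).
  by rewrite mulSn -[X in R X _]add0n shift.
have Rdvd a : R 0 a = (d %| a).
  apply/idP/idP=> [Ra|/dvdnP[q ->]]; last exact: Rmul.
  have : R 0 (a %% d).
    rewrite -(shift (a %/ d * d)%N) add0n addnC -divn_eq.
    by apply: Rtrans Ra; rewrite Rsym.
  (* the remainder of a would be a smaller positive choice for d *)
  rewrite /dvdn; case: posnP => // md Rmd.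
  have /mind : (0 < a %% d) && R 0 (a %% d) by rewrite md.
  by rewrite leqNgt ltn_pmod.
split=> //; first by rewrite -Rdvd.
have Rle a b : a <= b -> R a b = (a == b %[mod d]).
  move=> ab; rewrite -{1}(subnK ab) -[X in R X _]add0n shift Rdvd.
  by rewrite eq_sym eqn_mod_dvd.
move=> x y; rewrite -{1}[x]redK -{1}[y]redK -/(R x y).
have [/Rle//|/ltnW/Rle] := leqP x y.
by rewrite Rsym eq_sym.
Qed.

Lemma orbits_mod_full N : orbits_mod N r.*2 -> N :=: 1.
Proof.
move=> oN; apply/trivgP/subsetP=> g Ng; rewrite inE; apply/eqP/permP=> x.
rewrite perm1; apply/eqP; rewrite eq_sym vertex_eq -oN.
exact: mem_orbit.
Qed.

(** * Cyclic quotients and their groups *)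

Section Quotient.
Variables (N : {group {perm vertex}}) (d : nat).
Hypotheses (d_gt0 : 0 < d) (d_dvd : d %| r) (oN : orbits_mod N d).

Lemma dvd_double : d %| r.*2.
Proof. by rewrite -muln2 dvdn_mulr. Qed.

(** Since d divides r, adjacent vertices are consecutive modulo d; conversely
    a vertex x and a class consecutive to that of x always contain an edge,
    because x + 1 is a neighbour of x.  The degenerate cases d = 1 and d = 2
    are included, the formula for the edges of a cycle giving complete graphs
    there. *)
Lemma quotient_cycle :
  graph_iso (normal_quotient (Gam := sd_graph) N) (cycle_graph d).
Proof.
(* the default of odflt is never used, as orbits are not empty *)
pose f (A : @normal_quotient sd_graph N) : cycle_graph d :=
  Ordinal (ltn_pmod (odflt (red 0) [pick x in val A]) d_gt0).
have fE (A : @normal_quotient sd_graph N) (x : vertex) :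
    x \in val A -> f A = x %% d :> nat.
  case: A => A /= /imsetP[z _ ->{A}]; case: pickP => [y|/(_ z)]; last first.
    by rewrite orbit_refl.
  move=> /= zy zx; apply/eqP; rewrite -oN.
  by apply: orbit_trans zx _; rewrite orbit_sym.
have blockP x : orbit 'P N x \in @orbit_set sd_graph N by apply: imset_f.
pose block x : @normal_quotient sd_graph N :=
  exist (fun B : {set _} => B \in @orbit_set sd_graph N) _ (blockP x).
have f_block x : f (block x) = x %% d :> nat by apply: fE; apply: orbit_refl.
have blockE (A : @normal_quotient sd_graph N) :
    exists2 x : vertex, x \in val A & A = block x.
  case: A => A Ao; have /imsetP[x _ Ax] := Ao; exists x.
    by rewrite /= Ax orbit_refl.
  exact: val_inj.
have inj_f : injective f.
  move=> A B /(congr1 (@nat_of_ord d)).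
  have [[x _ ->] [y _ ->]] := (blockE A, blockE B); rewrite !f_block => /eqP xy.
  by apply: val_inj; apply/esym/orbit_eqP; rewrite oN.
have bij_f : bijective f.
  apply: (@Bijective _ _ f (fun i => block (red i))) => [A|i].
    apply: inj_f; apply: (@ord_inj d).
    by rewrite f_block red_mod ?modn_small // dvd_double.
  by apply: (@ord_inj d); rewrite f_block red_mod ?dvd_double // modn_small.
exists f => // A B.
rewrite /= /cycle_edge /quotient_edge (inj_eq inj_f); congr (_ && _).
have [[a aA _] [b bB _]] := (blockE A, blockE B).
rewrite (fE A a) // (fE B b) //.
have succ (u v : nat) : (u %% d == (v %% d).+1 %% d) = (u == v.+1 %[mod d]).
  by rewrite -!(addn1 v) -addn1 modnDml.
rewrite !succ; apply/idP/existsP => [ab | [x /andP[xA]]]; last first.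
  case/existsP=> y /andP[yB]; rewrite /sedge /= /adj.
  have xa : x = a %[mod d] by rewrite -(fE A x) // -(fE A a).
  have yb : y = b %[mod d] by rewrite -(fE B y) // -(fE B b).
  have down u v : u == v %[mod r] -> u == v %[mod d].
    by move/eqP=> uv; rewrite -(modn_dvdm u d_dvd) uv modn_dvdm.
  case/orP=> /down.
    by rewrite yb -(addn1 x) -modnDml xa modnDml addn1 => ->.
  by rewrite xa -(addn1 y) -modnDml yb modnDml addn1 => ->; rewrite orbT.
have memB (C : @normal_quotient sd_graph N) (c x : vertex) : c \in val C ->
    x = c %[mod d] -> x \in val C.
  have [z _ ->] := blockE C; move=> /= cz xc.
  by apply: orbit_trans cz; rewrite oN xc.
have succ_red (u : vertex) : red u.+1 = u.+1 %[mod r].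
  by apply: red_mod; rewrite -muln2 dvdn_mulr.
case/orP: ab => /eqP ab.
  exists a; rewrite aA; apply/existsP; exists (red a.+1); apply/andP; split.
    by apply: memB bB _; rewrite red_mod ?dvd_double.
  by rewrite /sedge /= /adj succ_red eqxx.
exists (red b.+1); apply/andP; split.
  by apply: memB aA _; rewrite red_mod ?dvd_double.
apply/existsP; exists b; rewrite bB /=.
by rewrite /adj succ_red eqxx orbT.
Qed.

Lemma card_orbit_set : #|@orbit_set sd_graph N| = d.
Proof.
have [f /bij_eq_card card_f _] := quotient_cycle.
rewrite -[RHS]card_ord -card_f card_sig; exact: eq_card.
Qed.

Lemma orbit_kernelP g : g \in sd_group ->
  reflect (forall x : vertex, g x = x %[mod d])
          (g \in orbit_kernel (Gam := sd_graph) sd_group N).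
Proof.
move=> Gg; rewrite in_setI Gg andTb; apply: (iffP idP) => [/astabP fixg x | modg].
  have oNx : orbit 'P N x \in @orbit_set sd_graph N by apply: imset_f.
  apply/eqP; rewrite eq_sym -oN -(fixg _ oNx).
  exact/imset_f/orbit_refl.
apply/astabP=> _ /imsetP[z _ ->]; apply/eqP.
rewrite eqEcard card_setact leqnn andbT.
apply/subsetP=> _ /imsetP[x zx ->].
by apply: orbit_trans zx; rewrite oN modg.
Qed.

Lemma orbit_kernel_normal : N <| sd_group ->
  orbit_kernel (Gam := sd_graph) sd_group N <| sd_group.
Proof.
case/andP=> _ nN; rewrite /normal subsetIl /=.
have pres u (x y : vertex) : u \in sd_group -> x = y %[mod d] -> u x = u y %[mod d].
  move=> Gu /eqP; rewrite -oN => xy; apply/eqP; rewrite -oN.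
  by rewrite orbit_norm ?(subsetP nN).
apply/subsetP=> u Gu; rewrite inE; apply/subsetP=> _ /imsetP[g Kg ->].
have Gg : g \in sd_group by case/setIP: Kg.
apply/orbit_kernelP=> [|x]; first by rewrite groupJ.
rewrite conjgE !permM -{2}(permKV u x); apply: pres => //.
exact/orbit_kernelP.
Qed.

Lemma rotX_kernel j :
  (rot ^+ j \in orbit_kernel (Gam := sd_graph) sd_group N) = (d %| j).
Proof.
apply/orbit_kernelP/idP=> [|/(_ (red 0))|dj x]; first by rewrite groupX ?rot_in.
  by rewrite rotX_red add0n !red_mod ?dvd_double // mod0n => /eqP.
rewrite -{1}[x]redK rotX_red red_mod ?dvd_double //.
by rewrite -modnDmr (eqP dj) addn0.
Qed.

(** In the quotient the rotation has order d, because its j-th power fixes all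
    classes exactly when d divides j, and the semidihedral relation becomes
    the dihedral one, because d divides r.  So the quotient is an image of the
    dihedral group of order 2d whose order is a multiple of d; equality with d
    would put the flip in the cyclic group of rotations, making the rotation
    equal to its inverse, against d > 2. *)
Lemma kernel_quotient_dihedral : 2 < d -> N <| sd_group ->
  sd_group / orbit_kernel (Gam := sd_graph) sd_group N \isog 'D_(d.*2).
Proof.
move=> d_gt2 nN.
pose K : {group {perm vertex}} :=
  ('C_(sd_group)(@orbit_set sd_graph N | 'P^*))%G.
have nK : sd_group \subset 'N(K) by apply: normal_norm (orbit_kernel_normal nN).
change (sd_group / K \isog 'D_(d.*2)).
have memK j : (rot ^+ j \in K) = (d %| j) by apply: rotX_kernel.
have nrot : rot \in 'N(K) by rewrite (subsetP nK) ?rot_in.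
have nflip : flip \in 'N(K) by rewrite (subsetP nK) ?flip_in.
have rX j : (coset K rot ^+ j == 1) = (d %| j).
  rewrite -morphX //= -memK; apply/eqP/idP=> [|/coset_id//].
  by apply: coset_idr; rewrite groupX.
have orot : #[coset K rot] = d.
  apply/eqP; rewrite eqn_dvd order_dvdn rX dvdnn /=.
  by rewrite -rX expg_order.
have genQ : <[coset K rot]> <*> <[coset K flip]> = sd_group / K.
  rewrite /sd_group /= quotient_gen ?subUset ?sub1set ?nrot ?nflip //.
  by rewrite quotientU !quotient_set1 // joing_idl joing_idr.
have invQ : coset K rot ^ coset K flip = (coset K rot)^-1.
  apply/eqP; rewrite -morphJ // rot_flip morphX // eq_sym eq_invg_mul -expgS.
  by rewrite rX prednK //; apply: leq_trans r_gt2.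
have homQ : sd_group / K \homg 'D_(d.*2).
  rewrite Grp_dihedral; last by apply: ltnW.
  apply/existsP; exists (coset K rot, coset K flip).
  rewrite /= !xpair_eqE genQ eqxx rX dvdnn /= invQ eqxx.
  by rewrite -morphX // (expgS _ 1) expg1 flip2 morph1 eqxx.
apply/(isoGrpP _ (Grp_dihedral (ltnW d_gt2))); split; last first.
  by rewrite -Grp_dihedral // ltnW.
rewrite card_dihedral; last exact: ltnW.
have := card_homg homQ; rewrite card_dihedral; last exact: ltnW.
have sub : <[coset K rot]> \subset sd_group / K.
  by rewrite -genQ joing_subl.
have /dvdnP[k kE] := cardSg sub; move: kE; rewrite -orderE orot => kE.
rewrite kE -mul2n dvdn_pmul2r // => /(dvdn_leq (isT : 0 < 2)) k2.
case: k kE k2 => [|[|[|k]]] kE // _.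
  by move: (cardG_gt0 (sd_group / K)); rewrite kE.
have /eqP eqQ : <[coset K rot]> == sd_group / K.
  by rewrite eqEcard sub kE mul1n -orderE orot leqnn.
have /cycleP[j flip_rot] : coset K flip \in <[coset K rot]>.
  by rewrite eqQ mem_quotient ?flip_in.
have /eqP : coset K rot ^+ 2 = 1.
  rewrite (expgS _ 1) expg1 -{1}(invgK (coset K rot)) -invQ flip_rot.
  by rewrite conjgE (commuteX j (commute_refl _)) mulKg mulVg.
by rewrite rX => /dvdn_leq -/(_ isT); rewrite leqNgt d_gt2.
Qed.
End Quotient.

Lemma rotX_normal j : <[rot ^+ j]> <| sd_group.
Proof.
rewrite /normal cycle_subG groupX ?rot_in //= gen_subG subUset !sub1set.
rewrite !inE -!cycleJ !cycle_subG !conjXg rot_flip conjgE mulKg cycle_id /=.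
by rewrite -expgM mulnC expgM mem_cycle.
Qed.

Lemma rotX_orbits_mod d : d %| r.*2 -> orbits_mod <[rot ^+ d]> d.
Proof.
move=> dv x y; apply/imsetP/idP=> [[g /cycleP[i ->] ->] | xy].
  rewrite /= /aperm -expgM -[X in (rot ^+ _) X]redK rotX_red red_mod //.
  by rewrite mulnC addnC modnMDl.
have lex : x <= y + r.*2 by have := ltn_ord x; lia.
have /dvdnP[q qE] : d %| y + r.*2 - x.
  by rewrite -eqn_mod_dvd // -modnDmr (eqP dv) addn0 eq_sym.
exists (rot ^+ (q * d)); first by rewrite mulnC expgM mem_cycle.
rewrite /= /aperm -qE -[X in (rot ^+ _) X]redK rotX_red -[LHS]redK; apply/eqP.
by rewrite red_eq subnKC // modnDr.
Qed.

End SemidihedralGraph.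

(** * The unbounded family *)

Lemma small_cycle_complete d : d <= 2 ->
  graph_iso (cycle_graph d) (complete_graph d).
Proof.
move=> d2; exists id; first by exists id.
move=> i j; rewrite /= /cycle_edge /complete_edge.
rewrite -(inj_eq (@ord_inj d)).
move: (nat_of_ord i) (nat_of_ord j) (ltn_ord i) (ltn_ord j) => a b.
by case: d d2 {i j} => [|[|[|]]] //; case: a => [|[|]]; case: b => [|[|]].
Qed.

Lemma graph_iso_trans X Y Z : graph_iso X Y -> graph_iso Y Z -> graph_iso X Z.
Proof.
case=> f bij_f ef [g bij_g eg]; exists (g \o f); first exact: bij_comp.
by move=> x y; rewrite /= eg ef.
Qed.

(* Normal quotients are counted as graphs on sets of orbits: those of N and M
   coincide exactly when N and M have the same orbits. *)
Theorem theorem7p1 (m : nat) (hm : 1 <= m) :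
  exists (Gam : sgraph) (G : {group {perm Gam}}),
    [/\ OG4 G, basic G
      & exists N : 'I_m -> {group {perm Gam}},
          (forall i, unoriented_cyclic_quotient G (N i)) /\
          injective (fun i => orbit_set (N i))].
Proof.
pose r := (2 ^ m.+1)%N.
have r_gt2 : 2 < r by apply: (@leq_trans (2 ^ 2)); rewrite // leq_exp2l.
have r_even : ~~ odd r by rewrite oddX.
have r2E : r.*2 = (2 ^ m.+2)%N by rewrite -mul2n -expnS.
exists (sd_graph r_gt2), (sd_group r_gt2 r_even); split.
- split; [exact: sd_connected | exact: sd_regular | exact: sd_group_aut |].
  exact: sd_oriented.
- move=> N nN N1; have [d [d_gt0 d2 oN]] := normal_orbits_mod nN.
  have d_dvd : d %| r.
    move: d2; rewrite r2E => /(dvdn_pfactor d m.+2 (isT : prime 2))[i].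
    rewrite leq_eqVlt.
    case/orP=> [/eqP -> dE | im ->]; last by rewrite dvdn_exp2l.
    (* for d = 2r the orbits are singletons *)
    case/eqP: N1; apply: (orbits_mod_full r_gt2).
    by rewrite r2E -dE.
  have cyc := quotient_cycle r_gt2 d_gt0 d_dvd oN.
  have [d_gt2|d_le2] := ltnP 2 d; first by apply: Or33; exists d.
  have := graph_iso_trans cyc (small_cycle_complete d_le2).
  case: d d_gt0 d_le2 {d2 oN d_dvd cyc} => [|[|[|]]] // _ _.
    exact: Or31.
  exact: Or32.
pose e (i : 'I_m) := (2 ^ i.+2)%N.
pose N (i : 'I_m) : {group {perm sd_graph r_gt2}} := <[rot r_gt2 ^+ e i]>%G.
have e_dvd i : e i %| r by apply: dvdn_exp2l; exact: (ltn_ord i).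
have e_gt0 i : 0 < e i by rewrite expn_gt0.
have oN i : orbits_mod (N i) (e i).
  by apply: (rotX_orbits_mod r_gt2 r_even); rewrite -muln2 dvdn_mulr.
exists N; split=> [i | i j].
  have nN : N i <| sd_group r_gt2 r_even by apply: rotX_normal.
  have e_gt2 : 2 < e i by apply: (@leq_trans (2 ^ 2)); rewrite // leq_exp2l.
  split=> //; exists (e i); split=> //; first exact: quotient_cycle.
  exact: kernel_quotient_dihedral.
move/(congr1 (fun A : {set _} => #|A|)).
rewrite !(card_orbit_set r_gt2 (e_gt0 _) (e_dvd _) (oN _)).
by move/expnI => /(_ isT) [] /ord_inj.
Qed.
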